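(* Let $U,V,W\subset\mathbb{C}$ be nonempty compact sets. If $B_+\in \Psi E_+(U,V,W)$ is Fredholm, then at least one of $\alpha(B_+)$ and $\beta(B_+)$ is zero.
   Context: $\mathbb{N}=\{1,2,\dots\}$. $M_+(U,V,W)$ is the set of semi-infinite tridiagonal matrices $(a_{ij})_{i,j\in\mathbb{N}}$ with subdiagonal entries $a_{i,i-1}\in U$, diagonal entries $a_{i,i}\in V$, superdiagonal entries $a_{i,i+1}\in W$, all other entries zero. $M_n(U,V,W)$ is the set of $n\times n$ matrices of the same kind. Matrices in $M_+(U,V,W)$ act as bounded operators on $\ell^p(\mathbb{N})$, where $p\in[1,\infty]$; their invertibility, Fredholmness and (if Fredholm) index do not depend on $p$. $A_+\in M_+(U,V,W)$ is pseudoergodic, $A_+\in \Psi E_+(U,V,W)$, if for every $n\in\mathbb N$, every $B\in M_n(U,V,W)$ and every $\varepsilon>0$ there is a submatrix $C$ of $A_+$ composed of rows and columns $k+1,\dots,k+n$ of $A_+$, for some integer $k\ge 0$, with $\|B-C\|<\varepsilon$. For a bounded operator $B$, $\alpha(B)$ is the dimension of its null space and $\beta(B)$ the codimension of its image; $B$ is Fredholm if both are finite. *)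

(* Defs.v *)
From HB Require Import structures.
From mathcomp Require Import all_boot all_order all_algebra.
From mathcomp Require Import complex.
From mathcomp Require Import all_classical all_reals all_analysis.

Set Implicit Arguments.
Unset Strict Implicit.
Unset Printing Implicit Defensive.

Import Order.TTheory GRing.Theory Num.Theory.
Import numFieldNormedType.Exports.

Local Open Scope classical_set_scope.
Local Open Scope ring_scope.
Local Open Scope complex_scope.

(* The cast makes the topology and the norm of a numFieldType available on the
   complex numbers, on which they are not declared directly. *)
Definition C (R : realType) : numClosedFieldType := R[i].

(** ** Dimension and codimension *)

Section Dimension.
Variables (K : fieldType) (V : lmodType K).

(* dim (X / W) = n, for linear subspaces W `<=` X of V: the classes modulo W of
   the vectors v_0, ..., v_(n-1) of X form a basis of X / W. *)
Definition quotient_dim (X W : set V) (n : nat) : Prop :=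
  exists v : 'I_n -> V,
    [/\ forall i, X (v i),
        forall c : 'I_n -> K, W (\sum_(i < n) c i *: v i) -> forall i, c i = 0
      & forall x, X x -> exists c : 'I_n -> K, W (x - \sum_(i < n) c i *: v i)].

Definition dimension (X : set V) (n : nat) : Prop := quotient_dim X [set 0] n.

Definition codimension (X W : set V) (n : nat) : Prop := quotient_dim X W n.

Variables (E : set V) (T : V -> V).

(* alpha(T) = n and beta(T) = n for an operator T mapping the subspace E of V
   into itself; the codimension of the image is taken in E, not in V. *)
Definition alpha_is (n : nat) : Prop := dimension [set x | E x /\ T x = 0] n.

Definition beta_is (n : nat) : Prop := codimension E (T @` E) n.

Definition Fredholm : Prop := (exists a, alpha_is a) /\ (exists b, beta_is b).

End Dimension.

(** ** Tridiagonal matrices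

  Rows and columns are numbered from 0 instead of 1. *)

Section Tridiagonal.
Variable R : realType.
Local Notation C := (C R).
Variables U V W : set C.

Definition tridiag_entry (i j : nat) (z : C) : Prop :=
  if i == j.+1 then U z
  else if i == j then V z
  else if j == i.+1 then W z
  else z = 0.

Definition M_fin (n : nat) (B : 'M[C]_n) : Prop :=
  forall i j : 'I_n, tridiag_entry i j (B i j).

Definition M_plus (A : nat -> nat -> C) : Prop :=
  forall i j : nat, tridiag_entry i j (A i j).

Definition principal_block (A : nat -> nat -> C) (k n : nat) : 'M[C]_n :=
  \matrix_(i < n, j < n) A (k + i)%N (k + j)%N.

(* The norm on 'M[C]_n is the largest modulus of an entry; as n is fixed before
   eps, any other matrix norm gives the same notion. *)
Definition PsiE_plus (A : nat -> nat -> C) : Prop :=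
  M_plus A /\
  forall n : nat, (0 < n)%N ->
  forall B : 'M[C]_n, M_fin B ->
  forall eps : R, 0 < eps ->
  exists k : nat, `|B - principal_block A k n| < eps%:C.

End Tridiagonal.

(** ** The operator induced on l^p *)

Section Operator.
Variable R : realType.
Local Notation C := (C R).

Definition modulus (z : C) : R := complex.Re `|z|.

Definition ell (p : \bar R) : set (nat -> C) :=
  [set x : nat -> C | ('N[counting]_p[EFin \o (modulus \o x)] < +oo)%E].

(* For a tridiagonal A this is the full product: A i j = 0 when j > i.+1. *)
Definition tridiag_op (A : nat -> nat -> C) (x : nat -> C) : nat -> C :=
  fun i => \sum_(j < i.+2) A i j * x j.

End Operator.

(* Main.v *)
(* If neither alpha nor beta vanishes, there are x <> 0 in l^p with B x = 0 and
   a bounded y <> 0 with B^T y = 0.  Let A be the bi-infinite tridiagonal matrix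
   which is B to the right of row q, the flip of B^T to its left, and (u, v, w)
   in row q.  The sequence (c flip(y), 0, d x) lies in its kernel as soon as
   u c y_0 + w d x_0 = 0, which has a solution (c, d) <> (0, 0).  Damping it by
   t^|i-q| with t close to 1 and cutting it off gives finitely supported
   approximate kernel vectors of A; by pseudoergodicity A is found
   approximately in B, arbitrarily far out, so these become vectors with
   disjoint supports on which B is arbitrarily small.  As B has a bounded inverse
   modulo its kernel, these vectors are close to the kernel, whose dimension
   would then be infinite.

   The functional analysis uses that tridiagonal operators are continuous for
   pointwise convergence and that l^p balls are pointwise compact, for every p
   including infinity.  Hence the images of balls are closed, Baire's argument
   bounds preimages modulo a complement of the range, and y arises by
   expanding the unit vectors along that complement: y = 0 would make all unit
   vectors, and by compactness all of l^p, lie in the range. *)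

Require Import Defs.
From HB Require Import structures.
From mathcomp Require Import all_boot all_order all_algebra.
From mathcomp Require Import complex.
From mathcomp Require Import all_classical all_reals all_analysis.
From mathcomp Require Import finmap ess_sup_inf.
From mathcomp Require Import zify ring lra.

Import Order.TTheory GRing.Theory Num.Theory.
Import numFieldNormedType.Exports.

Local Open Scope classical_set_scope.
Local Open Scope ring_scope.

Set Implicit Arguments.
Unset Strict Implicit.

(** * Real-valued modulus and limits along ultrafilters *)

Section Modulus.
Variable R : realType.
Implicit Types z w : C R.
Local Open Scope complex_scope.

Lemma modulusE z : `|z| = (modulus z)%:C.
Proof. by rewrite /modulus; apply/esym/RRe_real; exact: normr_real. Qed.

Lemma modulus_ge0 z : 0 <= modulus z.
Proof. by rewrite -ler0c -modulusE normr_ge0. Qed.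

Lemma modulusD z w : modulus (z + w) <= modulus z + modulus w.
Proof. by rewrite -lecR rmorphD /= -!modulusE; exact: ler_normD. Qed.

Lemma modulusM z w : modulus (z * w) = modulus z * modulus w.
Proof. by apply: complexI; rewrite rmorphM /= -!modulusE normrM. Qed.

Lemma modulusN z : modulus (- z) = modulus z.
Proof. by apply: complexI; rewrite -!modulusE normrN. Qed.

Lemma modulusB z w : modulus (z - w) = modulus (w - z).
Proof. by rewrite -modulusN opprB. Qed.

Lemma modulus_real (a : R) : 0 <= a -> modulus (a%:C : C R) = a.
Proof. by move=> a0; apply: complexI; rewrite -modulusE ger0_norm// lecR. Qed.

Lemma modulus0 : modulus (0 : C R) = 0.
Proof. by apply: complexI; rewrite -modulusE normr0. Qed.

Lemma modulus1 : modulus (1 : C R) = 1.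
Proof. by apply: complexI; rewrite -modulusE normr1. Qed.

Lemma modulusV z : modulus z^-1 = (modulus z)^-1.
Proof. by apply: complexI; rewrite -modulusE normfV fmorphV /= -modulusE. Qed.

Lemma modulus_eq0 z : (modulus z == 0) = (z == 0).
Proof. by rewrite -(inj_eq (@complexI R)) -modulusE normr_eq0. Qed.

Lemma modulus_gt0 z : (0 < modulus z) = (z != 0).
Proof. by rewrite lt_def modulus_ge0 modulus_eq0 andbT. Qed.

Lemma modulus_continuous : continuous (@modulus R : C R -> R).
Proof.
move=> z; apply/(@cvgrPdist_lt _ _ _ (nbhs z)) => e e0.
have e0' : 0 < e%:C :> C R by rewrite ltcR.
have : \forall w \near z, `|z - w| < e%:C by apply: (@cvgr_dist_lt _ _ _ (nbhs z)).
apply: (@filterS _ (nbhs z)) => w /=; rewrite modulusE ltcR; apply: le_lt_trans.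
have h (a b : C R) : modulus a - modulus b <= modulus (a - b).
  by have := modulusD (a - b) b; rewrite subrK lerBlDr.
by rewrite ler_norml h lerNl opprB modulusB h.
Qed.

Lemma compact_modulus (A : set (C R)) :
  compact A -> exists2 M : R, 0 <= M & forall z, A z -> modulus z <= M.
Proof.
move=> cA.
have cm : compact ((@modulus R) @` A).
  by apply: continuous_compact cA; apply: continuous_subspaceT modulus_continuous.
have [M [_ MA]] := compact_bounded cm.
exists (`|M| + 1) => [|z Az]; first by rewrite addr_ge0.
have := MA (`|M| + 1); rewrite (le_lt_trans (ler_norm _))// ?ltrDl// => /(_ isT).
move=> /(_ (modulus z)); rewrite /= ger0_norm ?modulus_ge0//; apply.
by exists z.
Qed.

Lemma fmap_ultra (S T : Type) (f : S -> T) (F : set_system S) :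
  UltraFilter F -> UltraFilter (fmap f F).
Proof.
move=> FU; split; first exact: fmap_proper_filter.
move=> G GF FG; apply/seteqP; split; last exact: FG.
move=> A GA; have [//|FnA] := in_ultra_setVsetC (f @^-1` A) FU.
have /(filterI GA) : G (~` A) by exact: FG.
by rewrite setICr => /filter_ex [].
Qed.

(** Real and imaginary parts stay in the compact segment [[- M, M]]. A fixed ultrafilter gives
    limits in all coordinates at once, in place of a diagonal subsequence. *)
Lemma ultra_cvg (F : set_system nat) (u : nat -> C R) (M : R) :
  UltraFilter F -> (forall n, modulus (u n) <= M) -> exists l : C R, u @ F --> l.
Proof.
move=> FU uM.
have FF : Filter F by apply: filter_filter.
have cvgR (v : nat -> R) : (forall n, `|v n| <= M) -> exists l : R, v @ F --> l.
  move=> vM; have := @segment_compact _ (- M) M; rewrite compact_ultra.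
  move=> /(_ (v @ F) (fmap_ultra v FU))[|l [_ vl]]; last by exists l.
  by apply: (@filterE _ F) => n /=; rewrite in_itv /= -ler_norml.
have [|a ua] := cvgR (fun n => complex.Re (u n)).
  move=> n; apply: le_trans (uM n); rewrite -lecR -modulusE; exact: normc_ge_Re.
have [|b ub] := cvgR (fun n => complex.Im (u n)).
  move=> n; apply: le_trans (uM n); rewrite -lecR -modulusE.
  have := normc_ge_Re (u n * 'i%C).
  rewrite ReiNIm normrN normrM (_ : `|'i%C| = 1) ?mulr1//.
  by rewrite normc_def /= expr0n add0r expr1n sqrtr1.
exists (a +i* b); apply/cvgrPdist_lt => e e0.
have [r r0 ->] : exists2 r : R, 0 < r & e = r%:C.
  by exists (complex.Re e); [move: e0; rewrite ltcE => /andP[]|rewrite RRe_real// gtr0_real].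
have r2 : 0 < r / 2 by rewrite divr_gt0.
have H1 := @cvgr_dist_lt _ _ _ _ _ _ _ ua _ r2.
have H2 := @cvgr_dist_lt _ _ _ _ _ _ _ ub _ r2.
near=> n.
have h1 : `|a - complex.Re (u n)| < r / 2 by near: n; exact: H1.
have h2 : `|b - complex.Im (u n)| < r / 2 by near: n; exact: H2.
have -> : a +i* b - u n = (a - complex.Re (u n))%:C
    + 'i%C * (b - complex.Im (u n))%:C.
  by case: (u n) => c d /=; apply/eqP; rewrite eq_complex /=; apply/andP; split; apply/eqP; ring.
apply: (le_lt_trans (ler_normD _ _)).
rewrite normrM !normc_def /= !expr0n /= addr0 add0r expr1n sqrtr1 mul1r addr0.
by rewrite !sqrtr_sqr -rmorphD ltcR; lra.
Unshelve. all: by end_near. Qed.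

End Modulus.

(** * Norm bounds in [ell p] *)

Section LpNorm.
Variable R : realType.
Implicit Types (x y : nat -> C R) (a b : R) (p : \bar R).

(** An upper bound instead of the norm: since [a] is real, a bound also certifies membership in
    [ell p]. *)
Definition norm_le p x a : Prop :=
  ('N[counting]_p[EFin \o (@modulus R \o x)] <= a%:E)%E.

(** [0 <= a] has to be required: [powR] is nonnegative at every base, so the inequality of powers
    says nothing about the sign of [a]. *)
Definition pow_sum_le (r : R) x a : Prop :=
  0 <= a /\ forall n, \sum_(k < n) modulus (x k) `^ r <= a `^ r.

Lemma norm_le_finP (r : R) x a : 1 <= r ->
  norm_le r%:E x a <-> pow_sum_le r x a.
Proof.
move=> r1; have r0 : 0 < r by exact: lt_le_trans r1.
have sumE n : (\sum_(0 <= k < n) `|(EFin \o (@modulus R \o x)) k| `^ r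
    = (\sum_(k < n) modulus (x k) `^ r)%:E)%E.
  rewrite big_mkord -sumEFin; apply: eq_bigr => k _ /=.
  by rewrite ger0_norm// modulus_ge0.
have s0 : (0 <= \sum_(k <oo) `|(EFin \o (@modulus R \o x)) k| `^ r)%E.
  by apply: nneseries_ge0 => k _ _; exact: poweR_ge0.
rewrite /norm_le Lnorm_counting//; split=> [h|[a0 h]].
  have a0 : 0 <= a by rewrite -lee_fin (le_trans _ h)// poweR_ge0.
  split=> // n; rewrite -lee_fin -sumE.
  have /(le_trans _) : (\sum_(k <oo) `|(EFin \o (@modulus R \o x)) k| `^ r <= (a `^ r)%:E)%E.
    rewrite -poweR_EFin -[leLHS]poweRe1// -(mulVf (lt0r_neq0 r0)) poweRrM.
    by rewrite gt0_ler_poweR// ?in_itv /= ?leey ?andbT ?poweR_ge0 ?lee_fin// ltW.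
  by apply; apply: nneseries_lim_ge => k _ _; exact: poweR_ge0.
rewrite -[leRHS]poweRe1 ?lee_fin// -(mulfV (lt0r_neq0 r0)) poweRrM.
apply: gt0_ler_poweR; first by rewrite invr_ge0 ltW.
- by rewrite in_itv /= leey andbT.
- by rewrite in_itv /= leey andbT lee_fin powR_ge0.
rewrite poweR_EFin; apply: lime_le; first by apply: is_cvg_nneseries => k _ _; exact: poweR_ge0.
by apply: nearW => n; rewrite sumE lee_fin.
Qed.

(** Only the empty set is null for the counting measure, so the essential supremum is a plain
    one. *)
Lemma counting_ae (P : set nat) :
  (\forall k \ae (@counting nat R), P k) <-> forall k, P k.
Proof.
split=> [[N [mN N0 PN]] k|]; last exact: nearW.
apply: contrapT => Pk; have : N k by exact: PN.
move: N0; rewrite /= /counting; case: ifPn => [/asboolP fN|//].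
move=> [] /eqP; rewrite pnatr_eq0 cardfs_eq0 => /eqP N0.
by move=> Nk; move: (in_fset_set fN k); rewrite N0 !inE => /esym/negbT; rewrite mem_set.
Qed.

Lemma norm_le_inftyP x a : norm_le +oo%E x a <-> forall k, modulus (x k) <= a.
Proof.
rewrite /norm_le unlock /Lnorm ifT; last first.
  by rewrite /= /counting asboolF ?lt0y//; exact: infinite_nat.
split=> [/ess_supP/counting_ae h k|h].
  by have := h k; rewrite /= lee_fin ger0_norm// modulus_ge0.
apply/ess_supP/counting_ae => k.
by rewrite /= lee_fin ger0_norm// modulus_ge0.
Qed.

Section Props.
Variable p : \bar R.
Hypothesis p1 : (1 <= p)%E.

Lemma norm_le_ge0 x a : norm_le p x a -> 0 <= a.
Proof. by rewrite -lee_fin; apply: le_trans; exact: Lnorm_ge0. Qed.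

Lemma norm_leW x a b : a <= b -> norm_le p x a -> norm_le p x b.
Proof. by move=> ab h; apply: le_trans h _; rewrite lee_fin. Qed.

Lemma ellP x : ell p x <-> exists a, norm_le p x a.
Proof.
split=> [h|[a /le_lt_trans]]; last by apply; exact: ltry.
exists (fine ('N[counting]_p[EFin \o (@modulus R \o x)])%E).
by rewrite /norm_le fineK// ge0_fin_numE// Lnorm_ge0.
Qed.

Lemma ell_norm x : ell p x ->
  exists2 s, norm_le p x s & forall a, norm_le p x a -> s <= a.
Proof.
move=> h; have E := @fineK _ ('N[counting]_p[EFin \o (@modulus R \o x)])%E.
exists (fine ('N[counting]_p[EFin \o (@modulus R \o x)])%E).
  by rewrite /norm_le E// ge0_fin_numE// Lnorm_ge0.
by move=> a; rewrite /norm_le -E ?lee_fin// ge0_fin_numE// Lnorm_ge0.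
Qed.

Lemma norm_le_solid x y a :
  (forall k, modulus (x k) <= modulus (y k)) -> norm_le p y a -> norm_le p x a.
Proof.
move=> xy; case: p p1 => [r|_|//].
  rewrite lee_fin => r1; rewrite !norm_le_finP// => -[a0 h]; split=> // n.
  apply: le_trans (h n); apply: ler_sum => k _.
  by rewrite ge0_ler_powR ?nnegrE ?modulus_ge0// (le_trans ler01).
by rewrite !norm_le_inftyP => h k; exact: le_trans (xy k) (h k).
Qed.

Lemma norm_le_modulus x a k : norm_le p x a -> modulus (x k) <= a.
Proof.
case: p p1 => [r|_|//]; last by rewrite norm_le_inftyP.
rewrite lee_fin => r1; rewrite norm_le_finP// => -[a0 h].
have r0 : 0 < r by exact: lt_le_trans r1.
have := h k.+1; rewrite big_ord_recr /= => hk.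
rewrite leNgt; apply/negP => ax; move: hk; apply/negP; rewrite -ltNge.
apply: (lt_le_trans (gt0_ltr_powR r0 _ _ ax)); rewrite ?nnegrE ?modulus_ge0//.
by rewrite lerDr; apply: sumr_ge0 => *; exact: powR_ge0.
Qed.

(** Minkowski's inequality for the real sequences of moduli, whose sum dominates
    [modulus (x k + y k)]. *)
Lemma norm_leD x y a b :
  norm_le p x a -> norm_le p y b -> norm_le p (fun k => x k + y k) (a + b).
Proof.
move=> xa yb.
pose s (k : nat) : R := modulus (x k) + modulus (y k).
have s0 k : 0 <= s k by rewrite addr_ge0 ?modulus_ge0.
have sab : norm_le p (fun k => (s k)%:C%C) (a + b).
  rewrite /norm_le (_ : _ \o _ = s); last first.
    by apply/funext => k /=; rewrite modulus_real.
  rewrite EFinD; apply: le_trans (eminkowski _ _ _ p1) (leeD xa yb).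
    exact: (@measurable_funTS).
  by [].
apply: norm_le_solid sab => k.
by rewrite [leRHS]modulus_real// modulusD.
Qed.

Lemma norm_leZ (c : C R) x a :
  norm_le p x a -> norm_le p (fun k => c * x k) (modulus c * a).
Proof.
case: p p1 => [r|_|//].
  rewrite lee_fin => r1; rewrite !norm_le_finP// => -[a0 h].
  split=> [|n]; first by rewrite mulr_ge0 ?modulus_ge0.
  under eq_bigr do rewrite modulusM powRM ?modulus_ge0//.
  by rewrite -mulr_sumr powRM ?modulus_ge0// ler_wpM2l ?powR_ge0.
by rewrite !norm_le_inftyP => h k; rewrite modulusM ler_wpM2l ?modulus_ge0.
Qed.

Lemma norm_le_delta j : norm_le p (fun k => (k == j)%:R) 1.
Proof.
case: p p1 => [r|_|//].
  rewrite lee_fin => r1; rewrite norm_le_finP//; split=> // n; rewrite powR1.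
  have r0 : r != 0 by rewrite gt_eqF// (lt_le_trans _ r1).
  rewrite (eq_bigr (fun k : 'I_n => ((k : nat) == j)%:R)) => [|k _]; last first.
    by case: eqP => _; rewrite ?modulus1 ?powR1// modulus0 powR0.
  case: (ltnP j n) => jn.
    rewrite (bigD1 (Ordinal jn))//= eqxx big1 ?addr0// => k kj.
    by rewrite (_ : (k : nat) == j = false)//; apply: contra_neqF kj => /eqP kj; exact: val_inj.
  by rewrite big1// => k _; rewrite ltn_eqF// (leq_trans (ltn_ord k)).
by rewrite norm_le_inftyP => k; case: eqP => _; rewrite ?modulus1// modulus0.
Qed.

(** Each partial sum, and for [p = +oo] each coordinate, already occurs in a truncation. This
    reduces limit arguments to finitely many coordinates. *)
Lemma norm_le_fatou x a :
  (forall n, norm_le p (fun k => if (k < n)%N then x k else 0) a) ->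
  norm_le p x a.
Proof.
case: p p1 => [r|_|//].
  rewrite lee_fin => r1 h; rewrite norm_le_finP//; split=> [|n].
    by have := h 0%N; rewrite norm_le_finP// => -[].
  have := h n; rewrite norm_le_finP// => -[_ /(_ n)]; apply: le_trans.
  by apply: ler_sum => k _; rewrite ltn_ord.
move=> h; rewrite norm_le_inftyP => k.
by have := h k.+1; rewrite norm_le_inftyP => /(_ k); rewrite ltnSn.
Qed.

Lemma norm_le_shiftl x a : norm_le p x a -> norm_le p (fun k => x k.+1) a.
Proof.
case: p p1 => [r|_|//].
  rewrite lee_fin => r1; rewrite !norm_le_finP// => -[a0 h]; split=> // n.
  by apply: le_trans (h n.+1); rewrite big_ord_recl lerDr powR_ge0.
by rewrite !norm_le_inftyP.
Qed.

Lemma norm_le_shiftr x a :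
  norm_le p x a -> norm_le p (fun k => if k is j.+1 then x j else 0) a.
Proof.
case: p p1 => [r|_|//].
  rewrite lee_fin => r1; rewrite !norm_le_finP// => -[a0 h]; split=> // -[|n].
    by rewrite big_ord0 powR_ge0.
  have r0 : r != 0 by rewrite gt_eqF// (lt_le_trans _ r1).
  by rewrite big_ord_recl /= modulus0 powR0// add0r; exact: h.
rewrite !norm_le_inftyP => h [|k]; last exact: h.
by rewrite modulus0 (le_trans _ (h 0%N))// modulus_ge0.
Qed.

End Props.

End LpNorm.

(** * Pointwise limits and tridiagonal operators *)

Section UltraLimits.
Variable R : realType.
Implicit Types (x y f h : nat -> C R) (a b : R) (B : nat -> nat -> C R).

Lemma tridiag_opD B x y :
  tridiag_op B (fun k => x k + y k) = fun k => tridiag_op B x k + tridiag_op B y k.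
Proof.
apply/funext => i; rewrite /tridiag_op -big_split /=.
by apply: eq_bigr => j _; rewrite mulrDr.
Qed.

Lemma tridiag_opZ B (c : C R) x :
  tridiag_op B (fun k => c * x k) = fun k => c * tridiag_op B x k.
Proof.
apply/funext => i; rewrite /tridiag_op mulr_sumr.
by apply: eq_bigr => j _; rewrite mulrCA.
Qed.

Lemma tridiag_op_sum B (n : nat) (c : 'I_n -> C R) (x : 'I_n -> nat -> C R) :
  tridiag_op B (fun k => \sum_i c i * x i k) =
  fun k => \sum_i c i * tridiag_op B (x i) k.
Proof.
apply/funext => k; rewrite /tridiag_op.
under eq_bigr do rewrite mulr_sumr.
rewrite exchange_big /=; apply: eq_bigr => i _.
by rewrite mulr_sumr; apply: eq_bigr => j _; rewrite mulrCA.
Qed.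

Section Norm.
Variable p : \bar R.
Hypothesis p1 : (1 <= p)%E.

Lemma norm_le_eq x y a : x =1 y -> norm_le p x a -> norm_le p y a.
Proof. by move=> xy; apply: norm_le_solid => // k; rewrite xy. Qed.

Lemma norm_le0 : norm_le p (fun=> 0 : C R) 0.
Proof.
have := norm_leZ p1 0 (norm_le_delta p1 0); rewrite modulus0 mul0r.
by apply: norm_le_eq => k; rewrite mul0r.
Qed.

Lemma norm_le_finsum (n : nat) (c : 'I_n -> C R) (x : 'I_n -> nat -> C R) (a : 'I_n -> R) :
  (forall i, norm_le p (x i) (a i)) ->
  norm_le p (fun k => \sum_i c i * x i k) (\sum_i modulus (c i) * a i).
Proof.
elim: n c x a => [|n IH] c x a xa.
  by rewrite big_ord0; apply: norm_le_eq norm_le0 => k; rewrite big_ord0.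
rewrite big_ord_recl; apply: norm_le_eq (norm_leD p1 (norm_leZ p1 (c ord0) (xa ord0))
  (IH (fun i => c (lift ord0 i)) _ _ (fun i => xa (lift ord0 i)))) => k.
by rewrite big_ord_recl.
Qed.

Lemma norm_le_trunc x n :
  norm_le p (fun k => if (k < n)%N then x k else 0) (\sum_(i < n) modulus (x i)).
Proof.
have := norm_le_finsum (fun i : 'I_n => x i) (fun i => norm_le_delta p1 i).
under eq_bigr do rewrite mulr1.
apply: norm_le_eq => k; case: ltnP => kn.
  rewrite (bigD1 (Ordinal kn))//= eqxx mulr1 big1 ?addr0// => i ik.
  rewrite (_ : k == i = false) ?mulr0//; apply: contra_neqF ik => /eqP ki.
  exact/esym/val_inj.
by rewrite big1// => i _; rewrite gtn_eqF ?mulr0// (leq_trans (ltn_ord i)).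
Qed.

Variable F : set_system nat.
Context {FF : ProperFilter F}.

Lemma cvg_fin_sum (n : nat) (u : 'I_n -> nat -> C R) (l : 'I_n -> C R) :
  (forall i, u i @ F --> l i) -> (fun k => \sum_i u i k) @ F --> \sum_i l i.
Proof.
move=> ul; apply: cvg_big => [|i _]; last exact: ul.
exact: add_continuous.
Qed.

Lemma tridiag_op_cvg B (u : nat -> nat -> C R) (l : nat -> C R) :
  (forall i, (fun k => u k i) @ F --> l i) ->
  forall i, (fun k => tridiag_op B (u k) i) @ F --> tridiag_op B l i.
Proof. by move=> ul i; apply: cvg_fin_sum => j; apply: cvgMl_tmp; exact: ul. Qed.

(** At a suitable [k] the first [n] coordinates of [l] and [u k] are so close that the truncations
    differ by at most [e] in norm; [norm_le_fatou] removes the truncation. *)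
Lemma norm_le_cvg (u : nat -> nat -> C R) (l : nat -> C R) a :
  (forall i, (fun k => u k i) @ F --> l i) ->
  (\forall k \near F, norm_le p (u k) a) -> norm_le p l a.
Proof.
move=> ul ua; apply: norm_le_fatou => // n.
rewrite /norm_le; apply/lee_addgt0Pr => e e0; rewrite -EFinD.
suff : norm_le p (fun i => if (i < n)%N then l i else 0) (a + e) by [].
(* Dividing by [n.+1] keeps the tolerance positive when [n = 0]. *)
have e0' : 0 < (e / n.+1%:R)%:C%C :> C R by rewrite ltcR divr_gt0.
have [k [uka ulk]] : exists k, norm_le p (u k) a /\
    forall i : 'I_n, modulus (l i - u k i) <= e / n.+1%:R.
  apply: (@filter_ex _ F); apply: filterI ua _; apply: filter_forall => i.
  have := @cvgr_dist_le _ _ _ _ _ _ _ (ul i) _ e0' => /(_ (@filter_filter _ F _)).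
  by apply: (@filterS _ F _) => k; rewrite modulusE lecR.
have h : norm_le p (fun i => if (i < n)%N then u k i else 0) a.
  by apply: (norm_le_solid p1 _ uka) => i; case: ifP => // _; rewrite modulus0 modulus_ge0.
have H := norm_leD p1 (norm_le_trunc (fun i => l i - u k i) n) h.
apply: norm_leW (norm_le_eq _ H) => [|i]; last by case: ifP => _; rewrite ?subrK// addr0.
rewrite addrC lerD2l; apply: le_trans (ler_sum _ (fun i _ => ulk i)) _.
rewrite sumr_const card_ord -[leLHS]mulr_natl mulrCA ger_pMr//.
by rewrite ler_pdivrMr// mul1r ler_nat.
Qed.

End Norm.

(** Refining [\oo] makes limits along [F] agree with ordinary limits where these exist. *)
Lemma ultra_infty : exists F, UltraFilter F /\ \oo `<=` F.
Proof. exact: ultraFilterLemma. Qed.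

Lemma ultra_cvg_family (F : set_system nat) (u : nat -> nat -> C R) (M : nat -> R) :
  UltraFilter F -> (forall k i, modulus (u k i) <= M i) ->
  exists l : nat -> C R, forall i, (fun k => u k i) @ F --> l i.
Proof.
move=> FU uM; have /choice[l ul] : forall i, exists l : C R, (fun k => u k i) @ F --> l.
  by move=> i; apply: (ultra_cvg FU (M := M i)) => k; exact: uM.
by exists l.
Qed.

End UltraLimits.

(** * Baire's argument: bounded preimages modulo a complement of the range *)

Section BoundedInverse.
Variable R : realType.
Variable p : \bar R.
Hypothesis p1 : (1 <= p)%E.
Variable B : nat -> nat -> C R.
Local Notation T := (tridiag_op B).
Variables (m : nat) (v : 'I_m -> nat -> C R).

(** The image of the ball of radius [a] under the map taking [h] and [c] to [T h] plus a combination
    of the [v i], which will span a complement of the range. *)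
Definition solvable_le (a : R) (f : nat -> C R) : Prop :=
  exists (h : nat -> C R) (c : 'I_m -> C R),
    [/\ norm_le p h a, forall i, modulus (c i) <= a
      & f = fun k => T h k + \sum_i c i * v i k].

Lemma solvable_leW a b f : a <= b -> solvable_le a f -> solvable_le b f.
Proof.
move=> ab [h [c [ha ca ->]]]; exists h, c; split=> //; first exact: norm_leW ab ha.
by move=> i; exact: le_trans (ca i) ab.
Qed.

Lemma solvable_leZ (z : C R) a f :
  solvable_le a f -> solvable_le (modulus z * a) (fun k => z * f k).
Proof.
move=> [h [c [ha ca ->]]]; exists (fun k => z * h k), (fun i => z * c i); split.
- exact: norm_leZ.
- by move=> i; rewrite modulusM ler_wpM2l ?modulus_ge0.
apply/funext => k; rewrite tridiag_opZ mulrDr mulr_sumr; congr (_ + _).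
by apply: eq_bigr => i _; rewrite mulrA.
Qed.

Lemma solvable_leD a b f g :
  solvable_le a f -> solvable_le b g -> solvable_le (a + b) (fun k => f k + g k).
Proof.
move=> [h [c [ha ca ->]]] [h' [c' [hb cb ->]]].
exists (fun k => h k + h' k), (fun i => c i + c' i); split.
- exact: norm_leD.
- by move=> i; apply: le_trans (modulusD _ _) _; exact: lerD.
apply/funext => k; rewrite tridiag_opD addrACA; congr (_ + _).
by rewrite -big_split; apply: eq_bigr => i _; rewrite mulrDl.
Qed.

(** The bounded [h] and [c] converge pointwise along [F]; each row of [T] involves finitely many
    coordinates, so the equation passes to the limit. *)
Lemma solvable_le_cvg F (u : nat -> nat -> C R) (f : nat -> C R) a :
  UltraFilter F -> (forall k, solvable_le a (u k)) ->
  (forall i, (fun k => u k i) @ F --> f i) -> solvable_le a f.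
Proof.
move=> FU ua uf.
have /choice[h /choice[c H]] : forall k, exists (h : nat -> C R) (c : 'I_m -> C R),
    [/\ norm_le p h a, forall i, modulus (c i) <= a
      & u k = fun j => T h j + \sum_i c i * v i j] by exact: ua.
have [h0 h0P] := @ultra_cvg_family R F h (fun=> a) FU
  (fun k i => norm_le_modulus p1 i (let: And3 x _ _ := H k in x)).
have /choice[c0 c0P] : forall i, exists l : C R, (fun k => c k i) @ F --> l.
  by move=> i; apply: (ultra_cvg FU (M := a)) => k; have [_ + _] := H k; exact.
exists h0, c0; split.
- by apply: (norm_le_cvg p1 h0P); apply: nearW => k; have [] := H k.
- move=> i.
  have ca : (fun k => modulus (c k i)) @ F --> modulus (c0 i).
    by apply: continuous_cvg; [exact: modulus_continuous|exact: c0P].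
  by apply: (cvgr_to_le ca); apply: nearW => k; have [_ + _] := H k; exact.
apply/funext => i; apply: (cvg_unique _ (uf i)); first exact: norm_hausdorff.
have -> : (fun k => u k i) = (fun k => T (h k) i + \sum_j c k j * v j i).
  by apply/funext => k; have [_ _ ->] := H k.
apply: cvgD; first exact: tridiag_op_cvg.
by apply: cvg_fin_sum => j; apply: cvgMr_tmp; exact: c0P.
Qed.

Hypothesis vgen : forall f, ell p f -> exists a, solvable_le a f.

(* [f] is half the difference of [g + f] and [g - f]. *)
Lemma solvable_le_center (g : nat -> C R) (r a : R) :
  (forall f, norm_le p (fun k => f k - g k) r -> solvable_le a f) ->
  forall f, norm_le p f r -> solvable_le a f.
Proof.
move=> H f fr.
have Hp : solvable_le a (fun k => g k + f k).
  by apply: H; apply: norm_le_eq fr => // k; rewrite addrC addKr.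
have Hm : solvable_le a (fun k => g k - f k).
  apply: H; apply: (norm_le_solid p1 _ fr) => k.
  by rewrite addrAC subrr add0r modulusN.
have := solvable_leD (solvable_leZ 2^-1 Hp) (solvable_leZ (- 2^-1) Hm).
have m2 : modulus (2^-1 : C R) = 2^-1.
  by rewrite -[RHS]modulus_real ?invr_ge0// fmorphV rmorph_nat.
rewrite modulusN m2 -mulrDl [X in X * a](_ : _ = 1) ?mul1r; last by field.
suff -> : (fun k => 2^-1 * (g k + f k) + - 2^-1 * (g k - f k)) = f by [].
by apply/funext => k; field.
Qed.

(* Baire: nested balls, the n-th one missing [solvable_le n]; these sets are
   closed for pointwise convergence by [solvable_le_cvg]. *)
Lemma bounded_inverse :
  exists a r : R, 0 < r /\ forall f, norm_le p f r -> solvable_le a f.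
Proof.
apply: contrapT => /forallNP noball.
have [F [FU Foo]] := ultra_infty.
(* A state consists of level, centre and radius. Positivity of the radius is a premise inside, so
   that a choice function exists on all states. *)
have step (s : nat * (nat -> C R) * R) : exists s' : (nat -> C R) * R, 0 < s.2 ->
    [/\ 0 < s'.2, s'.2 <= s.2 / 2,
        norm_le p (fun k => s'.1 k - s.1.2 k) (s.2 / 2) &
        forall f, norm_le p (fun k => f k - s'.1 k) s'.2 ->
          ~ solvable_le s.1.1%:R f].
  case: s => -[n g] r /=; have [r0|_] := boolP (0 < r); last by exists (g, r).
  have r2 : 0 < r / 2 by rewrite divr_gt0.
  (* If the whole ball of half radius were solvable at level [n], recentring it at the origin would
     contradict [noball]. *)
  have [g' [g'r g'n]] : exists g', norm_le p (fun k => g' k - g k) (r / 2) /\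
      ~ solvable_le n%:R g'.
    apply: contrapT => H; apply: (noball n%:R); exists (r / 2); split=> //.
    apply: (@solvable_le_center g) => f fr; apply: contrapT => fn.
    by apply: H; exists f.
  (* Otherwise sequences solvable at level [n], within [1 / (k + 1)] of [g'], would converge to [g']
     and make it solvable too. *)
  have [r' [r'0 H]] : exists r', 0 < r' /\
      forall f, norm_le p (fun k => f k - g' k) r' -> ~ solvable_le n%:R f.
    apply: contrapT => H; apply: g'n.
    have /choice[u uP] : forall k : nat, exists f,
        norm_le p (fun i => f i - g' i) k.+1%:R^-1 /\ solvable_le n%:R f.
      move=> k; apply: contrapT => Hk; apply: H; exists k.+1%:R^-1.
      by split=> [|f fk fn]; [rewrite invr_gt0|apply: Hk; exists f].
    apply: (@solvable_le_cvg F u) => // [k|i]; first by case: (uP k).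
    have H0 : (fun k => u k i) @ \oo --> g' i.
      apply/cvgrPdist_le => e e0.
      have [d d0 ->] : exists2 d : R, 0 < d & e = d%:C%C.
        exists (complex.Re e); first by move: e0; rewrite ltcE => /andP[].
        by rewrite RRe_real// gtr0_real.
      near=> k; rewrite modulusE lecR modulusB.
      apply: le_trans (norm_le_modulus p1 i (uP k).1) _.
      by apply: ltW; near: k; exact: (near_infty_natSinv_lt (PosNum d0)).
    by move=> A /H0; exact: Foo.
  exists (g', Num.min r' (r / 2)); split=> //=.
  - by rewrite lt_min r'0.
  - by rewrite ge_min lexx orbT.
  by move=> f fr; apply: H; apply: norm_leW fr; rewrite ge_min lexx.
have /choice[nxt nxtP] := step.
pose s := fix s n : (nat -> C R) * R :=
  if n is k.+1 then nxt (k, (s k).1, (s k).2) else ((fun=> 0), 1).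
have s0 n : 0 < (s n).2.
  by elim: n => [|n IH] //=; have [] := nxtP (n, (s n).1, (s n).2) IH.
have sP n := nxtP (n, (s n).1, (s n).2) (s0 n).
(* Radii at least halve, so half a radius is at most the difference of two consecutive radii, and
   these differences telescope. *)
have sub k l : (k <= l)%N ->
    norm_le p (fun i => (s l).1 i - (s k).1 i) ((s k).2 - (s l).2).
  move=> /subnK <-; elim: (l - k)%N => [|d IH].
    by rewrite subrr; apply: norm_le_eq (norm_le0 p1) => // i; rewrite subrr.
  have [_ h1 h2 _] := sP (d + k)%N.
  have := norm_leD p1 h2 IH => /(norm_le_eq p1) H.
  apply: (@norm_leW _ _ _ ((s (d + k)%N).2 / 2 + ((s k).2 - (s (d + k)%N).2))).
    rewrite addSn; set a := (s (d + k)%N).2; set b := (s (d + k).+1).2.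
    have : b <= a / 2 by exact: h1.
    by lra.
  by apply: H => i /=; rewrite addrA subrK.
have sub' k l : (k <= l)%N -> norm_le p (fun i => (s l).1 i - (s k).1 i) (s k).2.
  by move=> kl; apply: norm_leW (sub _ _ kl); rewrite gerBl ltW.
have sbd l i : modulus ((s l).1 i) <= 1.
  by have := norm_le_modulus p1 i (sub' 0%N l (leq0n l)); rewrite /= subr0.
have [g gP] := ultra_cvg_family FU sbd.
have gs k : norm_le p (fun i => g i - (s k).1 i) (s k).2.
  apply: (norm_le_cvg p1 (F := F) (u := fun l i => (s l).1 i - (s k).1 i)).
    by move=> i; apply: cvgB; [exact: gP|exact: cvg_cst].
  by apply: Foo; exists k => // l /= kl; exact: sub'.
have /vgen[a ga] : ell p g.
  by apply/ellP; exists 1; apply: norm_le_eq (gs 0%N) => // i; rewrite subr0.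
(* [g] lies in every ball, also in the one that excludes solvability at a level exceeding [a]. *)
have [_ _ _ H] := sP (Num.truncn `|a|).+1; apply: (H g (gs _.+1)).
apply: solvable_leW ga; apply: le_trans (ler_norm _) (ltW _).
by rewrite truncnS_gt.
Unshelve. all: by end_near. Qed.

End BoundedInverse.

(** * Bounded solutions on the range, and the kernel of the transpose *)

Section FredholmConsequences.
Variable R : realType.
Variable p : \bar R.
Hypothesis p1 : (1 <= p)%E.
Variable B : nat -> nat -> C R.
Local Notation T := (tridiag_op B).
Variables (m : nat) (v : 'I_m -> nat -> C R).
Hypothesis vfree : forall (c : 'I_m -> C R) h, ell p h ->
  T h = (fun k => \sum_i c i * v i k) -> forall i, c i = 0.
Variables a r : R.
Hypothesis r0 : 0 < r.
Hypothesis solv : forall f, norm_le p f r -> solvable_le p B v a f.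

Lemma ellB x y : ell p x -> ell p y -> ell p (fun k => x k - y k).
Proof.
move=> /ellP[b xb] /ellP[c yc]; apply/ellP; exists (b + modulus (-1 : C R) * c).
by apply: norm_le_eq (norm_leD p1 xb (norm_leZ p1 (-1) yc)) => // k; rewrite mulN1r.
Qed.

Lemma ell_finsum n (c : 'I_n -> C R) (x : 'I_n -> nat -> C R) :
  (forall i, ell p (x i)) -> ell p (fun k => \sum_i c i * x i k).
Proof.
move=> xp; have /choice[b xb] : forall i, exists b, norm_le p (x i) b.
  by move=> i; apply/ellP.
by apply/ellP; exists (\sum_i modulus (c i) * b i); exact: norm_le_finsum.
Qed.

Lemma tridiag_opB x y : T (fun k => x k - y k) = fun k => T x k - T y k.
Proof.
apply/funext => i; rewrite /tridiag_op -sumrB.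
by apply: eq_bigr => j _; rewrite mulrBr.
Qed.

(** Scale [T u] to norm at most [r] and solve. As [T u] is in the range, [vfree] forces the
    coefficients along [v] to vanish; scaling back gives the bound. *)
Lemma solve_range u b : ell p u -> 0 < b -> norm_le p (T u) b ->
  exists2 h, norm_le p h (b / r * a) & T u = T h.
Proof.
move=> up b0 Tb; pose s := ((r / b)%:C%C : C R).
have br0 : 0 < b / r by rewrite divr_gt0.
have ms : modulus s = r / b by rewrite modulus_real// divr_ge0// ltW.
have sm : s * (b / r)%:C%C = 1.
  by rewrite -rmorphM /= mulrA divfK ?mulfV ?gt_eqF.
have /solv[h [c [ha _ E]]] : norm_le p (fun k => s * T u k) r.
  by have := norm_leZ p1 s Tb; rewrite ms divfK ?gt_eqF.
have c0 : forall i, c i = 0.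
  apply: (vfree (h := fun k => s * u k - h k)).
    apply: ellB; last by apply/ellP; exists a.
    have [d ud] := (ellP p u).1 up.
    by apply/ellP; exists (modulus s * d); exact: norm_leZ.
  rewrite tridiag_opB tridiag_opZ; apply/funext => k.
  by have := congr1 (@^~ k) E; rewrite /= => ->; rewrite addrC addKr.
exists (fun k => (b / r)%:C%C * h k).
  have := norm_leZ p1 (b / r)%:C%C ha.
  by rewrite modulus_real// ltW.
rewrite tridiag_opZ; apply/funext => k.
have := congr1 (@^~ k) E; rewrite /= [X in _ + X]big1 ?addr0 => [<-|i _].
  by rewrite mulrA [_%:C%C * s]mulrC sm mul1r.
by rewrite c0 mul0r.
Qed.

(** Truncations of [f] are finite combinations of unit vectors, and [solve_range] bounds their
    preimages uniformly; a pointwise limit of these solves for [f]. Density of finite sequences,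
    false for [p = +oo], is thus avoided. *)
Lemma surjective_of_delta :
  (forall j : nat, exists h, ell p h /\ T h = fun k => (k == j)%:R) ->
  forall f, ell p f -> exists2 h, ell p h & T h = f.
Proof.
move=> /choice[d dP] f /ellP[b0 fb0].
have [F [FU Foo]] := ultra_infty.
(* [solve_range] requires a positive bound, even for [f = 0]. *)
pose b := b0 + 1.
have b_gt0 : 0 < b by rewrite ltr_wpDl// (norm_le_ge0 fb0).
have fb : norm_le p f b by apply: norm_leW fb0; rewrite lerDl.
pose fN n k := if (k < n)%N then f k else 0.
have fNE n : T (fun k => \sum_(i < n) f i * d i k) = fN n.
  rewrite tridiag_op_sum; apply/funext => k; rewrite /fN.
  under eq_bigr do rewrite (dP _).2.
  case: ltnP => kn.
    rewrite (bigD1 (Ordinal kn))//= eqxx mulr1 big1 ?addr0// => i ik.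
    rewrite (_ : k == i = false) ?mulr0//; apply: contra_neqF ik => /eqP ki.
    exact/esym/val_inj.
  by rewrite big1// => i _; rewrite gtn_eqF ?mulr0// (leq_trans (ltn_ord i)).
have /choice[h hP] : forall n, exists h, norm_le p h (b / r * a) /\ T h = fN n.
  move=> n; have [|||h hb E] := @solve_range (fun k => \sum_(i < n) f i * d i k) b.
  - by apply: ell_finsum => i; have [] := dP i.
  - exact: b_gt0.
  - rewrite fNE; apply: (norm_le_solid p1 _ fb) => k; rewrite /fN.
    by case: ifP => // _; rewrite modulus0 modulus_ge0.
  by exists h; rewrite -E fNE.
have [h0 h0P] := @ultra_cvg_family R F h (fun=> b / r * a) FU
  (fun k i => norm_le_modulus p1 i (hP k).1).
exists h0.
  apply/ellP; exists (b / r * a); apply: (norm_le_cvg p1 h0P).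
  by apply: nearW => k; have [] := hP k.
apply/funext => i; have Hi : (fun k => T (h k) i) @ F --> T h0 i by exact: tridiag_op_cvg.
apply: (cvg_unique _ Hi); first exact: norm_hausdorff.
apply: (@cvg_near_cst _ _ _ _ F); apply: Foo; exists i.+1 => // k /= ik.
by apply/eqP; rewrite (hP k).2 /fN ik.
Qed.

Hypothesis tri : forall i j, (i.+1 < j)%N || (j.+1 < i)%N -> B i j = 0.

Lemma tridiag_op_delta j :
  T (fun k => (k == j)%:R) = fun k => \sum_(i < j.+2) B i j * (k == i)%:R.
Proof.
apply/funext => k; rewrite /tridiag_op.
have D n (G : nat -> C R) (l : nat) :
    \sum_(i < n) G i * (l == i)%:R = if (l < n)%N then G l else 0.
  case: ltnP => kn.
    rewrite (bigD1 (Ordinal kn))//= eqxx mulr1 big1 ?addr0// => i ik.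
    rewrite (_ : l == i = false) ?mulr0//; apply: contra_neqF ik => /eqP ki.
    exact/esym/val_inj.
  by rewrite big1// => i _; rewrite gtn_eqF ?mulr0// (leq_trans (ltn_ord i)).
rewrite (D j.+2 (fun i => B i j)).
under eq_bigr do rewrite eq_sym.
rewrite D; case: ltnP => jk; case: ltnP => kj //.
  by rewrite tri// kj orbT.
by rewrite tri// jk.
Qed.

(** [y j] is a fixed coordinate of the [j]-th unit vector along the span of [v]. Such a coordinate
    annihilates the range, in particular each column of [B]; this is the equation of the
    transpose. *)
Lemma dual_kernel :
  ~ (forall f, ell p f -> exists2 h, ell p h & T h = f) ->
  exists (y : nat -> C R) (M : R),
    [/\ exists j, y j != 0, forall j, modulus (y j) <= M
      & forall j, \sum_(i < j.+2) B i j * y i = 0].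
Proof.
move=> nsurj.
have /existsNP[j0 j0P] : ~ forall j : nat, exists h, ell p h /\ T h = fun k => (k == j)%:R.
  by move=> /surjective_of_delta.
have /choice[h /choice[c hc]] : forall j : nat, exists h (c : 'I_m -> C R),
    [/\ ell p h, forall i, modulus (c i) <= r^-1 * a &
      (fun k => (k == j)%:R) = fun k => T h k + \sum_i c i * v i k].
  move=> j; pose s := (r%:C%C : C R).
  have ms : modulus s = r by rewrite modulus_real// ltW.
  have s0 : s != 0 by rewrite -modulus_gt0 ms.
  have /solv /(solvable_leZ p1 s^-1) : norm_le p (fun k => s * (k == j)%:R) r.
    by have := norm_leZ p1 s (norm_le_delta p1 j); rewrite ms mulr1.
  move=> [h [c [ha ca E]]]; exists h, c; split.
  - by apply/ellP; eexists; exact: ha.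
  - by move=> i; have := ca i; rewrite modulusV ms.
  by rewrite -E; apply/funext => k; rewrite mulKf.
(* The [j0]-th unit vector is outside the range, so some coordinate of it is nonzero. *)
have [i0 ci0] : exists i, c j0 i != 0.
  apply: contrapT => /forallNP c0; apply: j0P; have [hp _ E] := hc j0.
  exists (h j0); split=> //; rewrite E; apply/funext => k.
  by rewrite big1 ?addr0// => i _; have /negP := c0 i; rewrite negbK => /eqP ->; rewrite mul0r.
exists (fun j => c j i0), (r^-1 * a); split; first by exists j0.
  by move=> j; have [_ + _] := hc j; exact.
move=> j.
pose C' (l : 'I_m) := \sum_(i < j.+2) B i j * c i l.
(* Expand column [j] of [B] in unit vectors: subtracting the images of the [h i] leaves a
   combination of [v] that lies in the range. *)
apply: (vfree (c := C') (h := fun k => (k == j)%:R - \sum_(i < j.+2) B i j * h i k)).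
  apply: ellB; first by apply/ellP; exists 1; exact: norm_le_delta.
  by apply: ell_finsum => i; have [] := hc i.
rewrite tridiag_opB tridiag_op_sum tridiag_op_delta; apply/funext => k.
rewrite -sumrB /C'; under [RHS]eq_bigr do rewrite mulr_suml.
rewrite exchange_big /=; apply: eq_bigr => i _.
have [_ _ E] := hc i; have := congr1 (@^~ k) E => /= ->.
rewrite mulrDr addrAC subrr add0r mulr_sumr.
by apply: eq_bigr => l _; rewrite mulrA.
Qed.

End FredholmConsequences.

(** * Disjoint almost-kernel vectors against a finite-dimensional kernel *)

Section Bumps.
Variable R : realType.
Variable p : \bar R.
Hypothesis p1 : (1 <= p)%E.
Variable B : nat -> nat -> C R.
Local Notation T := (tridiag_op B).

(** A norm above 1/2 and at most 1, rather than equal to 1, is expressible by [norm_le] alone. *)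
Definition bump (L L' : nat) (u : nat -> C R) : Prop :=
  [/\ (L <= L')%N, forall k, ~~ (L <= k < L')%N -> u k = 0, norm_le p u 1
    & ~ norm_le p u 2^-1].

(** Otherwise there are [n.+1] disjoint bumps [u j], each within [eta] of the kernel: [u j - h j] is
    in it. A linear dependence [w] among these gives equal combinations of the [u j] and the [h j],
    the latter small; on the support of the bump of largest weight only that bump survives, so it is
    too small. *)
Lemma no_small_bumps (n : nat) (a r : R) : 0 < r ->
  (forall u b, ell p u -> 0 < b -> norm_le p (T u) b ->
     exists2 h, norm_le p h (b / r * a) & T u = T h) ->
  alpha_is (ell p) T n ->
  exists2 kappa, 0 < kappa & exists L, forall L' u,
    bump L L' u -> ~ norm_le p (T u) kappa.
Proof.
move=> r0 solve [e [_ _ egen]].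
(* [n.+1] errors of size [eta] add up to 1/4, below the lower bound 1/2 for bumps. *)
pose eta : R := (4 * n.+1%:R)^-1.
have eta0 : 0 < eta by rewrite invr_gt0 mulr_gt0.
(* This makes the preimage bound [kappa / r * a] at most [eta]; adding 1 keeps the denominator
   positive when [a = 0]. *)
pose kappa := r / (`|a| + 1) * eta.
have kappa0 : 0 < kappa by rewrite mulr_gt0 ?divr_gt0 ?ltr_wpDl.
exists kappa => //; apply: contrapT => /forallNP nobd.
have /choice[G GP] : forall L, exists Lu : nat * (nat -> C R),
    bump L Lu.1 Lu.2 /\ norm_le p (T Lu.2) kappa.
  move=> L; apply: contrapT => H; apply: (nobd L) => L' u uL uk.
  by apply: H; exists (L', u).
(* Each bump starts where the preceding one ends. *)
pose l j := iter j (fun L => (G L).1) 0%N.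
pose u j := (G (l j)).2.
have uP j : bump (l j) (l j.+1) (u j) /\ norm_le p (T (u j)) kappa by exact: GP.
have l_le i j : (i <= j)%N -> (l i <= l j)%N.
  move=> /subnK <-; elim: (j - i)%N => // d IH; apply: leq_trans IH _.
  by have [[]] := uP (d + i)%N.
have disj i j k : i != j -> u i k != 0 -> u j k = 0.
  move=> ij uik; have [[_ + _ _] _] := uP j; apply.
  have [[_ ui _ _] _] := uP i.
  have /andP[h1 h2] : (l i <= k < l i.+1)%N by apply: contraNT uik => /ui ->.
  apply/negP => /andP[h3 h4]; move: ij; rewrite neq_ltn => /orP[ij|ji].
  - by have := leq_trans h2 (leq_trans (l_le _ _ ij) h3); rewrite ltnn.
  - by have := leq_trans h4 (leq_trans (l_le _ _ ji) h1); rewrite ltnn.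
have /choice[h hP] : forall j, exists h, norm_le p h eta /\ T (u j) = T h.
  move=> j; have [[_ _ u1 _] uk] := uP j.
  have [h ha Th] := solve (u j) kappa ((ellP p (u j)).2 (ex_intro _ 1 u1)) kappa0 uk.
  exists h; split=> //; apply: norm_leW ha.
  rewrite /kappa [X in X / r](_ : _ = eta / (`|a| + 1) * r); last by ring.
  rewrite mulfK ?gt_eqF// -mulrA ger_pMr// mulrC ler_pdivrMr ?ltr_wpDl// mul1r.
  by rewrite (le_trans (ler_norm _))// lerDl.
have /choice[M MP] : forall j, exists c : 'I_n -> C R,
    (fun k => u j k - h j k) = fun k => \sum_i c i * e i k.
  move=> j; have [|c ce] := egen (fun k => u j k - h j k).
    split; last first.
      by rewrite tridiag_opB; have [_ ->] := hP j; apply/funext => k; rewrite subrr.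
    have [[_ _ u1 _] _] := uP j; have [h1 _] := hP j.
    by apply: ellB => //; apply/ellP; eexists; [exact: u1|exact: h1].
  exists c; apply/eqP; rewrite -subr_eq0; apply/eqP; move: ce => /= ce.
  by rewrite -[RHS]ce; apply/funext => k; rewrite !fctE fct_sumE.
pose A : 'M[C R]_(n.+1, n) := \matrix_(j < n.+1, i < n) M j i.
(* [n.+1] rows of coefficients in dimension [n] are dependent. *)
have /rowV0Pn[w /sub_kermxP wA w0] : kermx A != 0.
  rewrite -mxrank_eq0 mxrank_ker -lt0n subn_gt0 ltnS.
  by apply: leq_trans (rank_leq_col _) _.
have wuh k : \sum_(j < n.+1) w 0 j * u j k = \sum_(j < n.+1) w 0 j * h j k.
  apply/eqP; rewrite -subr_eq0 -sumrB; apply/eqP.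
  transitivity (\sum_(j < n.+1) \sum_(i < n) w 0 j * M j i * e i k).
    apply: eq_bigr => j _; rewrite -mulrBr.
    have := congr1 (@^~ k) (MP j) => /= ->.
    by rewrite mulr_sumr; apply: eq_bigr => i _; rewrite mulrA.
  rewrite exchange_big big1// => i _; rewrite -mulr_suml.
  suff -> : \sum_(j < n.+1) w 0 j * M j i = 0 by rewrite mul0r.
  have := congr1 (fun X : 'rV_n => X 0 i) wA; rewrite !mxE => E0.
  by rewrite -[RHS]E0; apply: eq_bigr => j _; rewrite mxE.
have [j0 j0M] : exists j0, forall j, modulus (w 0 j) <= modulus (w 0 j0).
  exists [arg max_(j > ord0) modulus (w 0 j)]%O.
  by case: arg_maxP => // i _ H j; exact: H.
have wj0 : 0 < modulus (w 0 j0).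
  rewrite lt_def modulus_ge0 andbT; apply: contra w0 => /eqP wj0.
  apply/eqP/rowP => j; rewrite mxE; apply/eqP; rewrite -modulus_eq0 eq_le modulus_ge0 andbT.
  by rewrite -wj0.
have [[_ _ _ un] _] := uP j0; apply: un.
have H := norm_le_finsum p1 (fun j : 'I_n.+1 => w 0 j) (fun j => (hP j).1).
have H2 : norm_le p (fun k => w 0 j0 * u j0 k) (modulus (w 0 j0) * 4^-1).
  apply: (@norm_leW _ _ _ (\sum_(j < n.+1) modulus (w 0 j) * eta)).
    apply: le_trans (ler_sum _ (fun j _ => ler_wpM2r (ltW eta0) (j0M j))) _.
    have etaE : eta * n.+1%:R = 4^-1.
      by rewrite /eta invfM mulfVK// pnatr_eq0.
    by rewrite sumr_const card_ord -[leLHS]mulr_natr -mulrA etaE.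
  apply: (norm_le_solid p1 _ H) => k; rewrite -wuh.
  have [->|uk] := eqVneq (u j0 k) 0; first by rewrite mulr0 modulus0 modulus_ge0.
  rewrite (bigD1 j0)//= big1 ?addr0// => j jj0; rewrite (disj j0 j) ?mulr0//.
  by rewrite eq_sym; apply: contra jj0 => /eqP/val_inj ->.
have := norm_leZ p1 (w 0 j0)^-1 H2; rewrite modulusV mulKf ?gt_eqF// => H3.
have w00 : w 0 j0 != 0 by rewrite -modulus_gt0.
apply: norm_leW (norm_le_eq p1 _ H3) => [|k]; last by rewrite mulKf.
by rewrite lef_pV2 ?posrE// ler_nat.
Qed.

End Bumps.

(** * The mirrored matrix and its kernel sequence *)

Section Transplant.
Variable R : realType.
Variables U V W : set (C R).
Variable B : nat -> nat -> C R.

Lemma tridiag_entry0 i j (z : C R) : (i.+1 < j)%N || (j.+1 < i)%N ->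
  tridiag_entry U V W i j z -> z = 0.
Proof.
by rewrite /tridiag_entry => ij; do 3! (case: eqP => [?|_]; first by lia).
Qed.

Lemma sum_tridiag_row (A : nat -> nat -> C R) (x : nat -> C R) i :
  (forall k l, (l.+1 < k)%N -> A k l = 0) ->
  \sum_(j < i.+3) A i.+1 j * x j =
  A i.+1 i * x i + A i.+1 i.+1 * x i.+1 + A i.+1 i.+2 * x i.+2.
Proof.
move=> tri; rewrite 3!big_ord_recr /= big1 ?add0r// => j _.
by rewrite tri ?mul0r// ltnS.
Qed.

Variables u0 v0 w0 : C R.

(* Restricted to nonnegative indices: the matrix A of the header, with the
   corner entries next to row [q] chosen so that it is tridiagonal. *)
Definition mirror (q i j : nat) : C R :=
  if (i < q)%N then
    if (j < q)%N then B (q - j.+1) (q - i.+1)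
    else if (j == q) && (i.+1 == q) then w0 else 0
  else if i == q then
    if j.+1 == q then u0 else if j == q then v0 else if j == q.+1 then w0 else 0
  else
    if (q < j)%N then B (i - q.+1) (j - q.+1)
    else if (j == q) && (i == q.+1) then u0 else 0.

(** Pseudoergodicity finds a block at an unknown offset [k]; moving the centre along with it turns
    that block into one of the matrix centred at [k + q]. *)
Lemma mirror_shift k q i j : mirror (k + q) (k + i) (k + j) = mirror q i j.
Proof.
by rewrite /mirror -!addnS !leq_add2l !eqn_add2l !subnDl.
Qed.

(** Reversing the indices exchanges sub- and superdiagonal and transposing exchanges them back, so
    flipped entries stay in [U], [V], [W] respectively. *)
Lemma mirror_M_plus q : M_plus U V W B -> U u0 -> V v0 -> W w0 ->
  M_plus U V W (mirror q).
Proof.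
move=> hB Uu Vv Ww i j; rewrite /tridiag_entry /mirror.
case: (ltngtP i q) => iq.
- case: ltnP => jq.
    have := hB (q - j.+1)%N (q - i.+1)%N; rewrite /tridiag_entry.
    have -> : (q - j.+1 == (q - i.+1).+1)%N = (i == j.+1) by lia.
    have -> : (q - j.+1 == q - i.+1)%N = (i == j) by lia.
    by have -> : (q - i.+1 == (q - j.+1).+1)%N = (j == i.+1) by lia.
  have -> : i == j.+1 = false by lia.
  have -> : i == j = false by lia.
  by case: eqP => ji; case: ifP => //; lia.
- case: ltnP => jq.
    have := hB (i - q.+1)%N (j - q.+1)%N; rewrite /tridiag_entry.
    have -> : (i - q.+1 == (j - q.+1).+1)%N = (i == j.+1) by lia.
    have -> : (i - q.+1 == j - q.+1)%N = (i == j) by lia.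
    by have -> : (j - q.+1 == (i - q.+1).+1)%N = (j == i.+1) by lia.
  have -> : j == i.+1 = false by lia.
  have -> : i == j = false by lia.
  by case: eqP => ji; case: ifP => //; lia.
rewrite iq (eq_sym q j) (eq_sym q j.+1).
by case: eqP => // _; case: eqP => // _; case: eqP.
Qed.

Lemma mirror_approx (q n : nat) (eps : R) : PsiE_plus U V W B ->
  U u0 -> V v0 -> W w0 -> (0 < n)%N -> 0 < eps ->
  exists k, forall i j, (i < n)%N -> (j < n)%N ->
    modulus (mirror (k + q) (k + i) (k + j) - B (k + i) (k + j)) <= eps.
Proof.
move=> [hB /(_ n) hn] Uu Vv Ww n0 e0.
have [|k kP] := hn n0 (\matrix_(i, j) mirror q i j) _ eps e0.
  by move=> i j; rewrite mxE; exact: mirror_M_plus.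
exists k => i j ni nj; rewrite mirror_shift -lecR -modulusE.
have : ball (\matrix_(i < n, j < n) mirror q i j) eps%:C%C (principal_block B k n).
  by rewrite mx_norm_ball.
move=> [_ /(_ (Ordinal ni) (Ordinal nj))].
by rewrite -ball_normE /= !mxE /= => /ltW.
Qed.

Variables (x y : nat -> C R) (c d : C R).

Definition glue (q i : nat) : C R :=
  if (i < q)%N then c * y (q - i.+1) else if i == q then 0 else d * x (i - q.+1).

(** Rows before [q] reduce to the equations of [y], rows after [q] to those of [x], row [q] to the
    condition on [c] and [d]; the zero at [q] suppresses the corner entries. Row 0 is left out, as
    its left neighbour is cut off. *)
Lemma mirror_glue q i :
  (forall k l, (k.+1 < l)%N || (l.+1 < k)%N -> B k l = 0) ->
  (forall i, \sum_(j < i.+2) B i j * x j = 0) ->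
  (forall j, \sum_(i < j.+2) B i j * y i = 0) ->
  u0 * (c * y 0%N) + w0 * (d * x 0%N) = 0 ->
  mirror q i.+1 i * glue q i + mirror q i.+1 i.+1 * glue q i.+1
    + mirror q i.+1 i.+2 * glue q i.+2 = 0.
Proof.
move=> tri Bx By cd.
have tri' k l : (l.+1 < k)%N -> B k l = 0 by move=> kl; apply: tri; rewrite kl orbT.
have tri'' k l : (l.+1 < k)%N -> B l k = 0 by move=> kl; apply: tri; rewrite kl.
rewrite /mirror /glue; case: (ltngtP i.+1 q) => iq /=.
- have [s qs] : exists s, q = (i.+2 + s)%N by exists (q - i.+2)%N; lia.
  have e1 : (q - i.+1 = s.+1)%N by lia.
  have e2 : (q - i.+2 = s)%N by lia.
  have e3 : (i.+2 < q)%N = (0 < s)%N by lia.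
  have e4 : (i.+2 == q) = (s == 0)%N by lia.
  (* [s = 0] is the row next to [q], where the equation of [y] has two terms only. *)
  rewrite e1 e2 e3 e4; case: s qs {e1 e2 e3 e4} => [|s] qs /=.
    rewrite mulr0 addr0.
    have := By 0%N; rewrite 2!big_ord_recr big_ord0 /= add0r => E.
    by rewrite mulrCA [X in _ + X]mulrCA -mulrDr addrC E mulr0.
  have -> : (q - i.+3 = s)%N by lia.
  have := By s.+1; rewrite (sum_tridiag_row (A := fun k l => B l k))// => E.
  rewrite mulrCA [X in _ + X + _]mulrCA [X in _ + X]mulrCA -!mulrDr.
  by rewrite -[RHS](mulr0 c) -[in RHS]E; congr (_ * _); ring.
- have [s is_] : exists s, i = (q + s)%N by exists (i - q)%N; lia.
  have e1 : (i.+1 - q.+1 = s)%N by lia.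
  have e2 : (i.+2 - q.+1 = s.+1)%N by lia.
  have e3 : (q < i)%N = (0 < s)%N by lia.
  have e4 : (i == q) = (s == 0)%N by lia.
  have e5 : (i.+1 == q.+1) = (s == 0)%N by lia.
  have e6 : (q < i.+2)%N by lia.
  have e7 : (i.+2 < q)%N = false by lia.
  have e8 : i.+2 == q = false by lia.
  rewrite e1 e2 e3 e4 e5 e6 e7 e8; case: s is_ {e1 e2 e3 e4 e5 e6 e7 e8} => [|s] is_ /=.
    rewrite mulr0 add0r.
    have := Bx 0%N; rewrite 2!big_ord_recr big_ord0 /= add0r => E.
    by rewrite mulrCA [X in _ + X]mulrCA -mulrDr E mulr0.
  have -> : (i - q.+1 = s)%N by lia.
  have := Bx s.+1; rewrite sum_tridiag_row// => E.
  rewrite mulrCA [X in _ + X + _]mulrCA [X in _ + X]mulrCA -!mulrDr.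
  by rewrite E mulr0.
have e1 : (i.+2 < q)%N = false by lia.
have e2 : i.+2 == q = false by lia.
have e3 : i.+3 == q = false by lia.
have e4 : i.+2 == q.+1 by lia.
have e5 : (i.+2 - q.+1 = 0)%N by lia.
have e6 : (q - i.+1 = 0)%N by lia.
by rewrite e1 e2 e3 e4 e5 e6 mulr0 addr0.
Qed.

End Transplant.

(** * Geometric weights with a cut-off *)

Section Weights.
Variable R : realType.
Variables (delta : R) (r : nat).
Hypothesis delta0 : 0 < delta.
Hypothesis r0 : (0 < r)%N.
Local Notation t := ((1 + delta)^-1).

Definition weight (d : nat) : R := if (d < r)%N then t ^+ d else 0.

(** The distances from which one step can cross the cut at [r]. *)
Definition boundary (d : nat) : bool := (d == r) || (d.+1 == r).

Lemma weight_ge0 d : 0 <= weight d.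
Proof.
rewrite /weight; case: ifP => // _.
by rewrite exprn_ge0// invr_ge0 addr_ge0// ltW.
Qed.

(** As [t * (1 + delta) = 1], consecutive powers differ by [delta] times the smaller one; crossing
    the cut costs the last weight. The bound is in terms of [weight d'] because [d'] will belong to
    the column, where this weight recombines with [z] into the damped sequence. *)
Lemma weight_step d d' : (d' <= d.+1)%N -> (d <= d'.+1)%N ->
  `|weight d' - weight d| <= delta * weight d' + (boundary d)%:R * t ^+ r.-1.
Proof.
have t0 : 0 < t by rewrite invr_gt0 addr_gt0.
have td : t + t * delta = 1.
  by rewrite -[X in X + _]mulr1 -mulrDr mulVf// gt_eqF// addr_gt0.
move=> dd' d'd; have := weight_ge0 d'; rewrite /boundary /weight.
move: t t0 td => t t0 td.
have tn n : 0 < t ^+ n by rewrite exprn_gt0.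
have := tn r.-1.
have td0 : 0 < t * delta by rewrite mulr_gt0.
have t1 : t <= 1 by rewrite -td lerDl ltW.
have [->|->|->] : [\/ d' = d, d' = d.+1 | d = d'.+1].
- case: (ltngtP d d') => h; [apply: Or32; lia|apply: Or33; lia|exact: Or31].
- move=> h1 h2; rewrite subrr normr0 addr_ge0// mulr_ge0// ?ler0n//; exact: ltW.
- move=> _ h; case: (ltnP d.+1 r) => dr.
    rewrite ltnW// (_ : (d == r) || (d.+1 == r) = false) ?mul0r ?addr0; last by lia.
    rewrite exprS ler0_norm; last by rewrite subr_le0 ler_piMl ?(ltW (tn _))//.
    by have := tn d; nra.
  rewrite mulr0 sub0r add0r normrN; case: (ltnP d r) => dr'.
    rewrite (_ : (d == r) || (d.+1 == r)); last by lia.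
    have -> : r.-1 = d by lia.
    by rewrite ger0_norm ?(ltW (tn _))// mul1r.
  by rewrite normr0 mulr_ge0 ?ler0n// ltW.
move=> _ h; case: (ltnP d'.+1 r) => dr.
  rewrite ltnW// (_ : (d'.+1 == r) || (d'.+2 == r) = (d'.+2 == r)); last by lia.
  have h3 : 0 <= (d'.+2 == r)%:R * t ^+ r.-1 by rewrite mulr_ge0 ?ler0n// ltW.
  rewrite exprS ger0_norm; last by rewrite subr_ge0 ler_piMl ?(ltW (tn _))//.
  have := tn d'; have : t * delta <= delta by rewrite ler_piMl// ltW.
  by nra.
case: (ltnP d' r) => dr'.
  rewrite (_ : (d'.+1 == r) || (d'.+2 == r)); last by lia.
  have -> : r.-1 = d' by lia.
  rewrite subr0 ger0_norm ?(ltW (tn _))// mul1r.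
  by rewrite lerDr mulr_ge0// ltW.
by rewrite subrr normr0 mulr0 add0r mulr_ge0 ?ler0n// ltW.
Qed.

End Weights.

(** * The operator on a damped kernel sequence *)

Section SmallBumps.
Variable R : realType.

(** With truncated subtraction, [i - q + (q - i)] is the distance from [i] to [q]. *)
Definition centered (delta : R) (r q : nat) (z : nat -> C R) (i : nat) : C R :=
  (weight delta r (i - q + (q - i)))%:C%C * z i.

(* [B u] is [(B - A) u] plus the commutator of [A] with the weight, as [A z = 0];
   the last term is the jump of the weight at the edge of its support. *)
Lemma centered_bound (A B : nat -> nat -> C R) (z : nat -> C R) (delta K M eps : R)
    (r q : nat) :
  0 < delta -> 0 <= K -> 0 <= M -> 0 <= eps -> (0 < r)%N -> (r < q)%N ->
  (forall k l, (l.+1 < k)%N -> A k l = 0) ->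
  (forall k l, (l.+1 < k)%N -> B k l = 0) ->
  (forall i j, modulus (A i j) <= K) ->
  (forall i, modulus (z i) <= M) ->
  (forall i, A i.+1 i * z i + A i.+1 i.+1 * z i.+1 + A i.+1 i.+2 * z i.+2 = 0) ->
  (forall i j, (i - q + (q - i) <= r)%N -> (i <= j.+1)%N -> (j <= i.+1)%N ->
     modulus (A i j - B i j) <= eps) ->
  let u := centered delta r q z in forall k,
  modulus (tridiag_op B u k) <=
    (eps + K * delta) * ((if k is j.+1 then modulus (u j) else 0) +
       modulus (u k) + modulus (u k.+1)) +
    3 * (K * M * (1 + delta)^-1 ^+ r.-1) *
       (boundary r (k - q + (q - k)))%:R.
Proof.
move=> d0 K0 M0 e0 r0 rq triA triB AK zM Az AB u [|k].
  (* [Az] does not cover row 0, but [r < q] makes [u] vanish at 0 and 1. *)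
  have h : modulus (tridiag_op B u 0) = 0.
    rewrite /tridiag_op 2!big_ord_recr big_ord0 /= /u /centered /weight.
    rewrite !ifF ?mul0r ?mulr0 ?addr0 ?modulus0//; lia.
  rewrite h addr_ge0// mulr_ge0 ?addr_ge0 ?modulus_ge0 ?mulr_ge0 ?ler0n//.
    exact: ltW.
  by rewrite exprn_ge0// invr_ge0 addr_ge0// ltW.
rewrite /tridiag_op sum_tridiag_row//.
pose D i := (i - q + (q - i))%N; rewrite -/(D k.+1).
pose w i := weight delta r (D i).
set tau := (1 + delta)^-1 ^+ r.-1.
have tau0 : 0 <= tau by rewrite exprn_ge0// invr_ge0 addr_ge0// ltW.
have [Dk|Dk] := ltnP r (D k.+1).
  have u0 j : (k <= j <= k.+2)%N -> u j = 0.
    by move=> jk; rewrite /u /centered /weight ifF ?mul0r//; move: Dk; rewrite /D; lia.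
  rewrite !u0 ?mulr0 ?addr0 ?modulus0; try lia.
  by rewrite !addr0 mulr0 add0r !mulr_ge0// ler0n.
(* The three subtracted terms form the weighted row equation [Az] and sum to zero. *)
have term j : (k.+1 <= j.+1)%N -> (j <= k.+2)%N ->
    modulus (B k.+1 j * u j - (w k.+1)%:C%C * (A k.+1 j * z j)) <=
    (eps + K * delta) * modulus (u j) + K * M * tau * (boundary r (D k.+1))%:R.
  move=> kj jk.
  have -> : B k.+1 j * u j - (w k.+1)%:C%C * (A k.+1 j * z j) =
      - ((A k.+1 j - B k.+1 j) * u j) + A k.+1 j * ((w j - w k.+1)%:C%C * z j).
    rewrite rmorphB /= /u /centered -/(D j) -/(w j); ring.
  apply: le_trans (modulusD _ _) _; rewrite modulusN.
  rewrite (modulusM (A k.+1 j - B k.+1 j)) (modulusM (A k.+1 j)).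
  rewrite (modulusM (w j - w k.+1)%:C%C) mulrDl -addrA.
  apply: lerD; first by apply: ler_wpM2r; [exact: modulus_ge0|apply: AB => //; lia].
  have -> : modulus ((w j - w k.+1)%:C%C : C R) = `|w j - w k.+1|.
    by apply: complexI; rewrite -modulusE normc_def /= expr0n addr0 sqrtr_sqr.
  have mu : modulus (u j) = w j * modulus (z j).
    by rewrite /u /centered modulusM modulus_real// weight_ge0.
  have ws := @weight_step _ delta r d0 r0 (D k.+1) (D j).
  have {}ws : `|w j - w k.+1| <= delta * w j + (boundary r (D k.+1))%:R * tau.
    by apply: ws; rewrite /D; lia.
  rewrite mu.
  apply: (@le_trans _ _ (K * ((delta * w j + (boundary r (D k.+1))%:R * tau) * modulus (z j)))).
    by apply: ler_pM; rewrite ?modulus_ge0 ?mulr_ge0 ?modulus_ge0// ler_wpM2r ?modulus_ge0.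
  rewrite mulrDl mulrDr; apply: lerD; first by rewrite !mulrA.
  set b := _%:R; have b0 : 0 <= b by rewrite ler0n.
  have := ler_wpM2l (mulr_ge0 (mulr_ge0 K0 b0) tau0) (zM j); lra.
have -> : B k.+1 k * u k + B k.+1 k.+1 * u k.+1 + B k.+1 k.+2 * u k.+2 =
    (B k.+1 k * u k - (w k.+1)%:C%C * (A k.+1 k * z k)) +
    (B k.+1 k.+1 * u k.+1 - (w k.+1)%:C%C * (A k.+1 k.+1 * z k.+1)) +
    (B k.+1 k.+2 * u k.+2 - (w k.+1)%:C%C * (A k.+1 k.+2 * z k.+2)).
  rewrite -[LHS]subr0 -[X in _ - X](mulr0 (w k.+1)%:C%C) -[in LHS](Az k); ring.
have := term k; have := term k.+1; have := term k.+2.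
rewrite !ltnS !leqnn !leqnSn !(leq_trans (leqnSn _) (leqnSn _)).
move=> /(_ isT isT) h2 /(_ isT isT) h1 /(_ isT isT) h0.
apply: le_trans (modulusD _ _) _; apply: le_trans (lerD (modulusD _ _) (lexx _)) _.
apply: le_trans (lerD (lerD h0 h1) h2) _.
by rewrite le_eqVlt; apply/orP; left; apply/eqP; ring.
Qed.

End SmallBumps.

(** The shift [(r + L).+2] keeps the support beyond [L], and a block of size [(r + L).+2 + r.+2]
    contains all rows within distance [r] together with their neighbours. *)
Lemma window_bounds (k r L : nat) (q := (k + (r + L).+2)%N) :
  [/\ (r < q)%N, (L <= q - r)%N,
      forall i, ~~ (L <= i < q + r)%N -> (i - q + (q - i) < r)%N = false
    & forall i j, (i - q + (q - i) <= r)%N -> (i <= j.+1)%N -> (j <= i.+1)%N ->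
        [/\ (k <= i)%N, (k <= j)%N, (i - k < (r + L).+2 + r.+2)%N
          & (j - k < (r + L).+2 + r.+2)%N]].
Proof.
rewrite /q; split=> [||i|i j]; [by lia|by lia|by lia|].
by move=> *; split; lia.
Qed.

(** The jump affects at most four rows, however large [r] is. *)
Lemma boundary_points (r q k : nat) : boundary r (k - q + (q - k)) ->
  [\/ k = q + r, k = q - r, k = q + r.-1 | k = q - r.-1]%N.
Proof.
rewrite /boundary => /orP[] /eqP lr; have [lq|lq] := leqP k q.
- by apply: Or42; lia.
- by apply: Or41; lia.
- by apply: Or44; lia.
- by apply: Or43; lia.
Qed.

(** * Small bumps arbitrarily far out *)

Section Existence.
Variable R : realType.
Variable p : \bar R.
Hypothesis p1 : (1 <= p)%E.

(** Triangle inequality over the sequence, its two shifts and [n] unit vectors of norm at most 1. *)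
Lemma norm_le_tridiag (u f : nat -> C R) (s c1 c2 : R) (n : nat)
    (chi : pred nat) (P : 'I_n -> nat) :
  0 <= c1 -> 0 <= c2 -> norm_le p u s ->
  (forall k, chi k -> exists l, k = P l) ->
  (forall k, modulus (f k) <=
     c1 * ((if k is j.+1 then modulus (u j) else 0) + modulus (u k) +
           modulus (u k.+1)) + c2 * (chi k)%:R) ->
  norm_le p f (c1 * (s + s + s) + c2 * n%:R).
Proof.
move=> c10 c20 us chiP fu.
have us' : norm_le p (fun k => (modulus (u k))%:C%C) s.
  by apply: (norm_le_solid p1 _ us) => k; rewrite modulus_real ?modulus_ge0.
have H1 := norm_leD p1 (norm_leD p1 (norm_le_shiftr p1 us') us') (norm_le_shiftl p1 us').
have H2 := norm_le_finsum p1 (fun=> 1) (fun l : 'I_n => norm_le_delta p1 (P l)).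
have := norm_leD p1 (norm_leZ p1 c1%:C%C H1) (norm_leZ p1 c2%:C%C H2).
under eq_bigr do rewrite modulus1 mulr1.
rewrite !modulus_real// sumr_const card_ord.
apply: norm_le_solid => // k; apply: le_trans (fu k) _.
rewrite [X in _ <= modulus X](_ : _ = (c1 * ((if k is j.+1 then modulus (u j) else 0)
    + modulus (u k) + modulus (u k.+1)) + c2 * \sum_(l < n) (k == P l)%:R)%:C%C); last first.
  rewrite rmorphD !rmorphM /= !rmorphD /= rmorph_sum /=.
  congr (_ * (_ + _ + _) + _ * _); first by case: k.
  by apply: eq_bigr => l _; rewrite mul1r rmorph_nat.
have S0 : 0 <= \sum_(l < n) (k == P l)%:R :> R by apply: sumr_ge0 => *; exact: ler0n.
rewrite modulus_real; last first.
  rewrite addr_ge0// mulr_ge0// !addr_ge0 ?modulus_ge0//.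
  by case: k {fu S0} => // j; exact: modulus_ge0.
rewrite lerD2l ler_wpM2l//; case: (boolP (chi k)) => // /chiP[l ->].
by rewrite (bigD1 l)//= eqxx lerDl; apply: sumr_ge0 => *; exact: ler0n.
Qed.

Variables U V W : set (C R).
Variable B : nat -> nat -> C R.
Variables (u0 v0 w0 : C R) (K M : R).
Hypotheses (Uu : U u0) (Vv : V v0) (Ww : W w0).
Hypothesis K0 : 0 <= K.
Hypothesis entK : forall i j z, tridiag_entry U V W i j z -> modulus z <= K.
Hypothesis hB : PsiE_plus U V W B.
Variables (x y : nat -> C R) (c d : C R).
Hypothesis Bx : forall i, \sum_(j < i.+2) B i j * x j = 0.
Hypothesis By : forall j, \sum_(i < j.+2) B i j * y i = 0.
Hypothesis cd0 : u0 * (c * y 0%N) + w0 * (d * x 0%N) = 0.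
Hypothesis glM : forall q i, modulus (glue x y c d q i) <= M.
Variables (j0 : nat) (zeta : R).
Hypothesis zeta0 : 0 < zeta.
Hypothesis gl0 : forall q, (j0 < q)%N -> exists i,
  (i - q + (q - i))%N = j0.+1 /\ zeta <= modulus (glue x y c d q i).

(** [kappa] fixes [delta] and [eps]; then [r] makes the jump small against a lower bound,
    independent of [r], for the norm [s] of [u]. Pseudoergodicity supplies the place, and [u / s] is
    the bump. *)
Lemma small_bumps (kappa : R) (L : nat) : 0 < kappa ->
  exists L' u, bump p L L' u /\ norm_le p (tridiag_op B u) kappa.
Proof.
move=> k0.
have M0 : 0 <= M by apply: le_trans (glM 0 0); exact: modulus_ge0.
(* With [eps] below, [3 * (eps + K * delta) <= kappa / 2]: half of the budget. *)
pose delta := kappa / (12 * (K + 1)).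
have K1 : 0 < K + 1 by rewrite ltr_wpDl.
have d0 : 0 < delta by rewrite divr_gt0// mulr_gt0.
pose eps := kappa / 12.
have e0 : 0 < eps by rewrite divr_gt0.
pose t := (1 + delta)^-1.
have t0 : 0 < t by rewrite invr_gt0 addr_gt0.
have t1 : t < 1 by rewrite invf_lt1 ?ltrDl// addr_gt0.
have tn n : 0 < t ^+ n by rewrite exprn_gt0.
(* The other half: four rows of at most [3 * K * M * eta] give at most [kappa / 2] times the lower
   bound [t ^+ j0.+1 * zeta] of the norm. *)
pose eta := kappa * (t ^+ j0.+1 * zeta) / (24 * (K * M + 1)).
have KM1 : 0 < K * M + 1 by rewrite ltr_wpDl// mulr_ge0.
have eta0 : 0 < eta by rewrite divr_gt0 ?mulr_gt0.
have [r0 r0P] : exists r, t ^+ r <= eta.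
  have /cvgrPdist_lt/(_ _ eta0) : (fun n => t ^+ n) @ \oo --> (0 : R).
    by apply: cvg_expr; rewrite ger0_norm// ltW.
  move=> [N _ /(_ N (leqnn N))] /=; rewrite sub0r normrN ger0_norm ?(ltW (tn _))// => h.
  by exists N; exact: ltW.
(* [r] also exceeds [j0.+1], so the cut keeps an index where the kernel sequence is at least
   [zeta]. *)
pose r := (r0 + j0.+2).+1.
have tr : t ^+ r.-1 <= eta.
  by apply: le_trans r0P; rewrite /r /= exprD ler_piMr ?(ltW (tn _))// exprn_ile1 ?ltW.
pose m := (r + L).+2.
have [k kP] := @mirror_approx R U V W B u0 v0 w0 m (m + r.+2) eps hB Uu Vv Ww isT e0.
have [rq Lq out inside] := window_bounds k r L.
pose q := (k + m)%N.
pose z := glue x y c d q.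
pose u := centered delta r q z.
have tri i j : (i.+1 < j)%N || (j.+1 < i)%N -> B i j = 0.
  by move=> ij; apply: tridiag_entry0 ij (hB.1 i j).
have mP := mirror_M_plus q hB.1 Uu Vv Ww.
have mtri i j : (j.+1 < i)%N -> mirror B u0 v0 w0 q i j = 0.
  by move=> ij; apply: tridiag_entry0 (mP i j); rewrite ij orbT.
have Bu : forall k, modulus (tridiag_op B u k) <=
    (eps + K * delta) * ((if k is j.+1 then modulus (u j) else 0) +
       modulus (u k) + modulus (u k.+1)) +
    3 * (K * M * t ^+ r.-1) * (boundary r (k - q + (q - k)))%:R.
  apply: (@centered_bound R (mirror B u0 v0 w0 q)) => //.
  - exact: ltW.
  - by move=> i j ij; apply: tri; rewrite ij orbT.
  - by move=> i j; apply: entK; exact: mP.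
  - exact: glM.
  - by move=> i; exact: mirror_glue.
  - move=> i j iq ij ji; have [ki kj ikm jkm] := inside i j iq ij ji.
    by have := kP _ _ ikm jkm; rewrite !subnKC.
have usupp i : ~~ (L <= i < q + r)%N -> u i = 0.
  by move=> h; rewrite /u /centered /weight out ?mul0r.
have ufin : ell p u.
  apply/ellP; exists (\sum_(i < q + r) modulus (u i)).
  apply: norm_le_eq (norm_le_trunc p1 u (q + r)) => // i.
  by case: ltnP => // h; rewrite usupp// (ltnNge i) h andbF.
have [s us smin] := ell_norm ufin.
have [i [iq iz]] : exists i, (i - q + (q - i))%N = j0.+1 /\ zeta <= modulus (z i).
  apply: gl0; apply: leq_trans rq; rewrite /r ltnS.
  exact/leqW/(leq_trans _ (leq_addl _ _))/leqW/leqnSn.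
have s_ge : t ^+ j0.+1 * zeta <= s.
  apply: le_trans (norm_le_modulus p1 i us); rewrite /u /centered modulusM iq.
  have -> : weight delta r j0.+1 = t ^+ j0.+1.
    by rewrite /weight ifT// /r ltnS (leq_trans (leqnSn _) (leq_addl _ _)).
  rewrite modulus_real; last by rewrite ltW.
  by rewrite ler_wpM2l// ltW.
have s0 : 0 < s by apply: lt_le_trans s_ge; rewrite mulr_gt0.
pose P (l : 'I_4) := nth 0%N [:: (q + r)%N; (q - r)%N; (q + r.-1)%N; (q - r.-1)%N] l.
have Bus : norm_le p (tridiag_op B u) (kappa * s).
  have Kd : K * delta <= kappa / 12.
    have -> : K * delta = kappa / 12 * (K / (K + 1)).
      by rewrite /delta; field; rewrite gt_eqF.
    by rewrite ler_piMr ?divr_ge0 ?(ltW k0)// ler_pdivrMr// mul1r lerDl.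
  have KMt : K * M * t ^+ r.-1 <= kappa * s / 24.
    apply: le_trans (ler_wpM2l (mulr_ge0 K0 M0) tr) _.
    have -> : K * M * eta =
        kappa * (t ^+ j0.+1 * zeta) / 24 * (K * M / (K * M + 1)).
      by rewrite /eta; field; rewrite gt_eqF.
    apply: (@le_trans _ _ (kappa * (t ^+ j0.+1 * zeta) / 24)).
      rewrite ler_piMr ?divr_ge0 ?mulr_ge0 ?(ltW k0) ?(ltW zeta0) ?(ltW (tn _))//.
      by rewrite ler_pdivrMr// mul1r lerDl.
    by rewrite ler_wpM2r// ler_wpM2l// ltW.
  pose chi k := boundary r (k - q + (q - k)).
  apply: norm_leW (norm_le_tridiag (chi := chi) (P := P) _ _ us _ Bu).
  - by move: Kd KMt s0; rewrite /eps => Kd KMt s0'; have := ler_wpM2r (ltW s0') Kd; lra.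
  - by apply: addr_ge0; [exact: ltW|apply: mulr_ge0 => //; exact: ltW].
  - by rewrite !mulr_ge0 ?ler0n ?(ltW (tn _)).
  move=> l /boundary_points.
  by case=> ->; [exists 0|exists 1|exists (@Ordinal 4 2 isT)|exists (@Ordinal 4 3 isT)].
exists (q + r)%N, (fun i => (s^-1)%:C%C * u i).
have ms : modulus ((s^-1)%:C%C : C R) = s^-1 by rewrite modulus_real// invr_ge0 ltW.
split; last first.
  rewrite tridiag_opZ; have := norm_leZ p1 (s^-1)%:C%C Bus.
  by rewrite ms mulrCA mulVf ?mulr1 ?gt_eqF.
split.
- by apply: leq_trans Lq _; rewrite (leq_trans (leq_subr _ _)) ?leq_addr.
- by move=> i' /usupp ->; rewrite mulr0.
- by have := norm_leZ p1 (s^-1)%:C%C us; rewrite ms mulVf ?gt_eqF.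
(* A norm at most 1/2 after division by [s] contradicts that [s] is the least bound of [u]. *)
move=> /(norm_leZ p1 s%:C%C); rewrite modulus_real ?ltW// => h.
have /smin : norm_le p u (s * 2^-1).
  apply: norm_le_eq h => // i'; rewrite mulrA -rmorphM /= mulfV ?gt_eqF//.
  by rewrite rmorph1 mul1r.
by move=> s_le; lra.
Qed.

End Existence.

(** * Deriving the contradiction *)

Unset Implicit Arguments.

Theorem corollary2p3 (R : realType) (U V W : set (C R))
    (U0 : U !=set0) (V0 : V !=set0) (W0 : W !=set0)
    (Uc : compact U) (Vc : compact V) (Wc : compact W)
    (p : \bar R) (p1 : (1 <= p)%E)
    (B : nat -> nat -> C R) (hB : PsiE_plus U V W B)
    (hF : Fredholm (ell p) (tridiag_op B)) :
  alpha_is (ell p) (tridiag_op B) 0 \/ beta_is (ell p) (tridiag_op B) 0.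
Proof.
have [|nalpha] := pselect (alpha_is (ell p) (tridiag_op B) 0); first by left.
have [|nbeta] := pselect (beta_is (ell p) (tridiag_op B) 0); first by right.
exfalso; case: hF => -[n hn] [m [v [_ vfree0 vspan]]].
have vfree (c : 'I_m -> C R) h : ell p h ->
    tridiag_op B h = (fun k => \sum_i c i * v i k) -> forall i, c i = 0.
  move=> hp hc; apply: vfree0; exists h => //; rewrite hc.
  by apply/funext => k; rewrite fct_sumE.
have vgen f : ell p f -> exists a, solvable_le p B v a f.
  move=> /vspan[c [h hp hc]]; have [b hb] := (ellP p h).1 hp.
  exists (b + \sum_i modulus (c i)), h, c; split.
  - by apply: norm_leW hb; rewrite lerDl; apply: sumr_ge0 => *; exact: modulus_ge0.
  - move=> i; rewrite (bigD1 i)//= addrCA lerDl addr_ge0 ?(norm_le_ge0 hb)//.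
    by apply: sumr_ge0 => *; exact: modulus_ge0.
  by apply/funext => k; rewrite hc !fctE fct_sumE subrK.
have [a [r [r0 solv]]] := bounded_inverse p1 vgen.
have tri i j : (i.+1 < j)%N || (j.+1 < i)%N -> B i j = 0.
  by move=> ij; apply: tridiag_entry0 ij (hB.1 i j).
(* With a trivial kernel the empty family would witness dimension 0; codimension 0 is excluded in
   the same way below. *)
have [x [xp Bx [jx xj]]] : exists x, [/\ ell p x, tridiag_op B x = (fun=> 0)
    & exists j, x j != 0].
  apply: contrapT => H; apply: nalpha; exists (fun=> 0); split=> [[]//|c _ []//|].
  move=> x [xp Bx]; exists (fun=> 0); rewrite big_ord0 subr0.
  apply: contrapT => x0; apply: H; exists x; split=> //.
  apply: contrapT => /forallNP xj; apply: x0; apply/funext => j.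
  by apply/eqP; have /negP := xj j; rewrite negbK.
have nsurj : ~ forall f, ell p f -> exists2 h, ell p h & tridiag_op B h = f.
  move=> surj; apply: nbeta; exists (fun=> 0); split=> [[]//|c _ []//|].
  by move=> f fp; exists (fun=> 0); rewrite big_ord0 subr0; exact: surj.
have [y [My [[jy yj] yM By]]] := dual_kernel p1 vfree r0 solv tri nsurj.
have [Mx xM] := (ellP p x).1 xp.
have {}xM i : modulus (x i) <= Mx by exact: (norm_le_modulus p1 i xM).
have Bx0 i : \sum_(j < i.+2) B i j * x j = 0 by exact: (congr1 (@^~ i) Bx).
have [[u0 Uu] [v0 Vv] [w0 Ww]] := And3 U0 V0 W0.
have [[KU KU0 UK] [KV KV0 VK] [KW KW0 WK]] :=
  And3 (compact_modulus Uc) (compact_modulus Vc) (compact_modulus Wc).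
pose K := KU + KV + KW.
have K0 : 0 <= K by rewrite !addr_ge0.
have entK i j z : tridiag_entry U V W i j z -> modulus z <= K.
  rewrite /tridiag_entry /K; case: eqP => _; first by move=> /UK; lra.
  case: eqP => _; first by move=> /VK; lra.
  by case: eqP => _; [move=> /WK; lra|move=> ->; rewrite modulus0].
(* One linear equation in two unknowns; if both coefficients vanish, any pair solves it. *)
have [c [d [cd0 cd]]] : exists c d : C R,
    u0 * (c * y 0) + w0 * (d * x 0) = 0 /\ (c != 0) || (d != 0).
  have [cd|] := boolP ((w0 * x 0 != 0) || (u0 * y 0 != 0)).
    exists (w0 * x 0), (- (u0 * y 0)); split; last by rewrite oppr_eq0.
    by ring.
  rewrite negb_or !negbK => /andP[/eqP wx /eqP uy].
  by exists 1, 1; rewrite !mul1r wx uy addr0 oner_eq0.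
have glM q i : modulus (glue x y c d q i) <= modulus c * My + modulus d * Mx.
  have cM : 0 <= modulus c * My.
    by rewrite mulr_ge0 ?modulus_ge0// (le_trans _ (yM 0%N)) ?modulus_ge0.
  have dM : 0 <= modulus d * Mx.
    by rewrite mulr_ge0 ?modulus_ge0// (le_trans _ (xM 0%N)) ?modulus_ge0.
  rewrite /glue; case: ifP => _.
    by rewrite modulusM ler_wpDr// ler_wpM2l ?modulus_ge0.
  case: ifP => _; first by rewrite modulus0 addr_ge0.
  by rewrite modulusM ler_wpDl// ler_wpM2l ?modulus_ge0.
(* The nonzero one of [c] and [d] yields a nonzero value of the glued sequence whose distance from
   [q] and modulus do not depend on [q]. *)
have [j0 [zeta [zeta0 gl0]]] : exists j0 zeta, 0 < zeta /\ forall q, (j0 < q)%N ->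
    exists i, (i - q + (q - i))%N = j0.+1 /\ zeta <= modulus (glue x y c d q i).
  case/orP: cd => [c0|d0].
    exists jy, (modulus (c * y jy)); split; first by rewrite modulus_gt0 mulf_neq0.
    move=> q jq; exists (q - jy.+1)%N; split.
      by rewrite subKn// (eqP (leq_subr _ _)).
    rewrite /glue ifT; last by rewrite ltn_subrL (leq_trans _ jq).
    by rewrite -subSn// subSS subKn// ltnW.
  exists jx, (modulus (d * x jx)); split; first by rewrite modulus_gt0 mulf_neq0.
  move=> q _; exists (q + jx.+1)%N; split.
    by rewrite addKn (eqP (leq_addr _ _)) addn0.
  rewrite /glue ifF; last by rewrite ltnNge leq_addr.
  rewrite ifF; last by rewrite -[X in _ == X]addn0 eqn_add2l.
  by rewrite addnS subSS addKn.
have solve u b : ell p u -> 0 < b -> norm_le p (tridiag_op B u) b ->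
    exists2 h, norm_le p h (b / r * a) & tridiag_op B u = tridiag_op B h.
  exact: (solve_range p1 vfree r0 solv).
have [kappa k0 [L nobump]] := no_small_bumps p1 r0 solve hn.
have [L' [u [uL uk]]] := small_bumps p1 Uu Vv Ww K0 entK hB Bx0 By cd0 glM zeta0 gl0 L k0.
exact: nobump uL uk.
Qed.
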